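(* A $k$-translatable groupoid of order $n$ has at least $n$ $k$-translatable sequences, each with respect to a different ordering; that is, if a groupoid $Q$ of order $n$ is $k$-translatable with respect to some ordering of its elements, then there are at least $n$ pairwise different orderings of the elements of $Q$ with respect to each of which $Q$ is $k$-translatable.
   Context: A groupoid is a set with a binary operation $\cdot$. For an integer $x$, $[x]_n$ denotes the residue of $x$ modulo $n$, represented in $\{1,\ldots,n\}$, with $0$ identified with $n$. For $1\le k<n$, a groupoid $Q$ of order $n$ is $k$-translatable with respect to an ordering $q_1,\ldots,q_n$ of its elements if in its multiplication table (rows and columns listed in this order) each row is obtained from the preceding one by cyclically shifting it $k$ places to the right, i.e. $q_i\cdot q_j=q_{i-1}\cdot q_{[j-k]_n}$ for all $j$ and all $2\le i\le n$. The first row $q_1\cdot q_1,\ldots,q_1\cdot q_n$ is then called the $k$-translatable sequence of $Q$ with respect to this ordering. *)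

(* Defs.v *)
From mathcomp Require Import all_boot all_fingroup.

Set Implicit Arguments.
Unset Strict Implicit.
Unset Printing Implicit Defensive.

Local Open Scope group_scope.

(* Indices are 0-based: q_i of the text is q (i - 1). An ordering is a finite
   function, so that two orderings differ iff they differ at some position;
   its bijectivity forces Q to have order n. *)
Definition ordering (n : nat) (Q : magmaType) (q : {ffun 'I_n -> Q}) : Prop :=
  bijective q.

(* ord_pred is the cyclic predecessor on 'I_n, so iterating it k times
   turns the column index j into [j - k]_n. *)
Definition k_translatable (n k : nat) (Q : magmaType)
    (q : {ffun 'I_n -> Q}) : Prop :=
  ordering q /\
  forall i j : 'I_n, 0 < i ->
    q i * q j = q (ord_pred i) * q (iter k (@ord_pred n) j).

Definition k_translatable_sequence (n k : nat) (Q : magmaType)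
    (q s : {ffun 'I_n -> Q}) : Prop :=
  k_translatable k q /\
  forall i j : 'I_n, i = 0 :> nat -> s j = q i * q j.

(* Main.v *)
Require Import Defs.
From mathcomp Require Import all_boot all_fingroup.

(** The rows of the multiplication table of a [k]-translatable groupoid are
    successive shifts of the first row by [k]. After all [n] rows the total
    displacement is [k * n], a multiple of [n], so the first row is in turn
    the shift by [k] of the last one. Hence the translation law holds for
    every row, with row indices read cyclically ([translate_row]). In that
    form it singles out no starting row, and it survives rotating the
    ordering ([k_translatable_rotate]). The [n] rotations of one ordering put
    [n] different elements in first place, so they are pairwise different
    ([rotate_inj]). *)

Lemma val_iter_ordS n m (i : 'I_n) : iter m (@ordS n) i = (i + m) %% n :> nat.
Proof.
elim: m => [|m IHm] /=; first by rewrite addn0 modn_small.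
by rewrite IHm -addn1 modnDml addn1 addnS.
Qed.

Lemma val_ord_pred_gt0 n (i : 'I_n) : 0 < i -> ord_pred i = i.-1 :> nat.
Proof.
move=> i_gt0 /=.
have -> : (i + n).-1 = i.-1 + n by rewrite -{1}(prednK i_gt0).
by rewrite modnDr modn_small // (leq_ltn_trans (leq_pred i)).
Qed.

Lemma val_iter_ord_pred n m (i : 'I_n) :
  m <= i -> iter m (@ord_pred n) i = i - m :> nat.
Proof.
elim: m => [|m IHm] lt_mi; first by rewrite subn0.
by rewrite iterS val_ord_pred_gt0 (IHm (ltnW lt_mi)) ?subn_gt0 // subnS.
Qed.

Lemma iter_ordS_order n (i : 'I_n) : iter n (@ordS n) i = i.
Proof. by apply: val_inj; rewrite /= val_iter_ordS modnDr modn_small. Qed.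

Lemma iter_ordS_ord_pred n m (i : 'I_n) :
  iter m (@ordS n) (ord_pred i) = ord_pred (iter m (@ordS n) i).
Proof. by elim: m => //= m ->; rewrite ord_predK ordSK. Qed.

Lemma iter_ordSK n m : cancel (iter m (@ordS n)) (iter m (@ord_pred n)).
Proof. by elim: m => // m IHm i; rewrite iterSr iterS ordSK IHm. Qed.

Lemma iter_ord_pred_order n (i : 'I_n) : iter n (@ord_pred n) i = i.
Proof. by rewrite -{1}(iter_ordS_order n i) iter_ordSK. Qed.

Section Translatable.

Context {n k : nat} {Q : magmaType} {q : {ffun 'I_n -> Q}}.
Hypothesis transq : k_translatable k q.

Lemma translate_rows_up m (i j : 'I_n) : m <= i ->
  (q i * q j = q (iter m (@ord_pred n) i)
                 * q (iter (m * k) (@ord_pred n) j))%g.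
Proof.
have [_ law] := transq.
elim: m => // m IHm lt_mi; rewrite (IHm (ltnW lt_mi)) law.
  by rewrite -iterD mulSn -iterS.
by rewrite val_iter_ord_pred ?subn_gt0 // ltnW.
Qed.

(** The only new case is the first row. Going up [n.-1] rows from the last row
    amounts, with the initial cyclic step back, to [n] steps on row indices
    and [n * k] steps on column indices, and both are full turns. *)
Lemma translate_row (i j : 'I_n) :
  (q i * q j = q (ord_pred i) * q (iter k (@ord_pred n) j))%g.
Proof.
have [i_gt0|i_le0] := ltnP 0 i; first by have [_ ->] := transq.
have n_gt0 : 0 < n by apply: leq_ltn_trans (ltn_ord i).
have i_eq0 : i = 0 :> nat by apply/eqP; rewrite -leqn0.
have last_i : ord_pred i = n.-1 :> nat.
  by rewrite /= i_eq0 add0n modn_small // prednK.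
rewrite (@translate_rows_up n.-1 (ord_pred i)) ?last_i //.
rewrite -iterSr prednK // iter_ord_pred_order -iterD addnC -mulSn prednK //.
by rewrite mulnC iterM iter_fix ?iter_ord_pred_order.
Qed.

Lemma k_translatable_rotate m :
  k_translatable k [ffun i => q (iter m (@ordS n) i)].
Proof.
have [bij_q _] := transq; split.
  apply: (@eq_bij _ _ (q \o iter m (@ordS n))) => [|i]; last by rewrite ffunE.
  by apply: bij_comp => //; apply: injF_bij; apply: can_inj (iter_ordSK n m).
move=> i j _; rewrite !ffunE translate_row iter_ordS_ord_pred.
congr (_ * q _)%g.
by elim: (k) => //= l IHl; rewrite iter_ordS_ord_pred IHl.
Qed.

Lemma rotate_inj :
  injective (fun t : 'I_n => [ffun i => q (iter t (@ordS n) i)]).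
Proof.
have [bij_q _] := transq.
move=> t u eq_tu; have n_gt0 : 0 < n by apply: leq_ltn_trans (ltn_ord t).
(* The rotation by [t] is recognised by its first entry, which is [q t]. *)
have rotate0 (v : 'I_n) : iter v (@ordS n) (Ordinal n_gt0) = v.
  by apply: val_inj; rewrite /= val_iter_ordS add0n modn_small.
have /ffunP/(_ (Ordinal n_gt0)) := eq_tu.
by rewrite !ffunE !rotate0 => /(bij_inj bij_q).
Qed.

End Translatable.

Theorem corollary2p8 (n k : nat) (hk1 : 1 <= k) (hkn : k < n) (Q : magmaType)
    (hQ : exists q : {ffun 'I_n -> Q}, k_translatable k q) :
  exists q s : 'I_n -> {ffun 'I_n -> Q},
    injective q /\ forall t : 'I_n, k_translatable_sequence k (q t) (s t).
Proof.
have [q transq] := hQ; have n_gt0 : 0 < n by apply: leq_ltn_trans hkn.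
pose rot_q (t : 'I_n) := [ffun i => q (iter t (@ordS n) i)].
exists rot_q, (fun t => [ffun j => rot_q t (Ordinal n_gt0) * rot_q t j]%g).
split; first exact: rotate_inj transq.
move=> t; split; first exact: k_translatable_rotate.
by move=> i j i_eq0; rewrite ffunE (_ : i = Ordinal n_gt0) //; apply: val_inj.
Qed.
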